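(* Let $(R_1,\mathcal L_1)$ and $(R_2,\mathcal L_2)$ be recursive rings with a recursive interpretation of a language. Suppose that MRDP holds in $(R_1,\mathcal L_1)$. Let $d:R_1\to R_2$ be a Diophantine map. Then $d$ is r.e. preserving.
   Context: A recursive ring is a ring $R$ with a fixed recursive representation, i.e. an injection $j:R\to\mathbb N$ with recursive image for which addition and multiplication are recursive; subsets of $R^k$ are recursive / recursively enumerable if their images under $j^k$ are. A language $\mathcal L$ (constants, functions, relations; always containing a constant $0$ and equality) has a recursive interpretation in $R$ if all its functions are interpreted by recursive functions and all its relations by recursive sets. Terms are built from constants and variables using functions of $\mathcal L$; basic formulas are $(t_1,\ldots,t_k)\in R'$ with $R'\in\mathcal L$ a $k$-ary relation (possibly equality). $S\subset R^k$ is Diophantine if $S=\{\vec x\in R^k\mid\exists\vec y\in R^l\ (f_1\wedge\cdots\wedge f_r)\}$ for some basic formulas $f_i$. $d:R_1\to R_2$ is a Diophantine map if the coordinatewise image $d(S)\subset R_2^k$ is Diophantine for all $k$ and all Diophantine $S\subset R_1^k$. MRDP holds in $(R,\mathcal L)$ if every recursively enumerable $S\subset R$ is Diophantine in $(R,\mathcal L)$. $f:R_1\to R_2$ is r.e. preserving if $f(S)\subset R_2$ is recursively enumerable for all recursively enumerable $S\subset R_1$. *)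

(* Defs.v *)
From mathcomp Require Import all_boot all_algebra.
From mathcomp Require Import boolp classical_sets.
Set Implicit Arguments.
Unset Strict Implicit.
Unset Printing Implicit Defensive.
Import GRing.Theory.
Local Open Scope classical_set_scope.
Local Open Scope ring_scope.

(* Primitive recursion and minimization act on the first argument. *)
Inductive recfun : nat -> Type :=
| Zero n : recfun n
| Succ : recfun 1
| Proj n (i : 'I_n) : recfun n
| Comp n m (f : recfun m) (g : 'I_m -> recfun n) : recfun n
| PrimRec n (f : recfun n) (g : recfun n.+2) : recfun n.+1
| Mu n (f : recfun n.+1) : recfun n.

(* [rgraph f v y]: the partial function [f] is defined at [v], with value [y].
   For [PrimRec], [s] is the course of values
   s(0) = f(x), s(i+1) = g(i, s(i), x). *)
Fixpoint rgraph n (f : recfun n) : n.-tuple nat -> nat -> Prop :=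
  match f in recfun n return n.-tuple nat -> nat -> Prop with
  | Zero _ => fun _ y => y = 0%N
  | Succ => fun v y => y = (thead v).+1
  | Proj _ i => fun v y => y = tnth v i
  | Comp _ m f g => fun v y =>
      exists2 w : m.-tuple nat,
        (forall i, rgraph (g i) v (tnth w i)) & rgraph f w y
  | PrimRec _ f g => fun v y =>
      exists s : nat -> nat,
        [/\ rgraph f [tuple of behead v] (s 0%N),
            forall i, (i < thead v)%N ->
              rgraph g [tuple of i :: s i :: behead v] (s i.+1)
          & y = s (thead v)]
  | Mu _ f => fun v y =>
      rgraph f [tuple of y :: v] 0%N /\
      forall z, (z < y)%N -> exists w, rgraph f [tuple of z :: v] w.+1
  end.

Definition total n (f : recfun n) : Prop := forall v, exists y, rgraph f v y.

Definition nat_recursive k (A : set (k.-tuple nat)) : Prop :=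
  exists chi : recfun k, forall v,
    (A v -> rgraph chi v 1%N) /\ (~ A v -> rgraph chi v 0%N).

Definition nat_re k (A : set (k.-tuple nat)) : Prop :=
  exists f : recfun k, forall v, A v <-> exists y, rgraph f v y.

(* The identification of subsets of [T] with subsets of [T^1]. *)
Definition pow1 (T : Type) (S : set T) : set (1.-tuple T) :=
  [set [tuple x] | x in S].

Section Representation.
Variables (T : Type) (j : T -> nat).

Definition recursive_in k (S : set (k.-tuple T)) : Prop :=
  nat_recursive (map_tuple j @` S).

Definition re_in k (S : set (k.-tuple T)) : Prop :=
  nat_re (map_tuple j @` S).

(* When [j] has recursive image, a partial recursive function defined on
   [j(T)^k] extends to a total one, so requiring totality is harmless. *)
Definition recursive_fun k (f : k.-tuple T -> T) : Prop :=
  exists2 F : recfun k,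
    total F & forall v, rgraph F (map_tuple j v) (j (f v)).

End Representation.

Record recRing := RecRing {
  recRing_sort :> pzRingType;
  rep : recRing_sort -> nat;
  rep_inj : injective rep;
  rep_image : nat_recursive (pow1 (range rep));
  rep_add : recursive_fun rep
    (fun v : 2.-tuple recRing_sort => tnth v ord0 + tnth v ord_max);
  rep_mul : recursive_fun rep
    (fun v : 2.-tuple recRing_sort => tnth v ord0 * tnth v ord_max)
}.

Definition recursive (R : recRing) k (S : set (k.-tuple R)) : Prop :=
  recursive_in (@rep R) S.

Definition re (R : recRing) k (S : set (k.-tuple R)) : Prop :=
  re_in (@rep R) S.

Record language := Language {
  lconst : Type;
  lfun : nat -> Type; (* indexed by arity *)
  lrel : nat -> Type;
  lzero : lconst;
  leqs : lrel 2
}.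

Record interp (L : language) (R : pzRingType) := Interp {
  iconst : lconst L -> R;
  ifun : forall k, lfun L k -> k.-tuple R -> R;
  irel : forall k, lrel L k -> set (k.-tuple R);
  izero : iconst (lzero L) = 0;
  ieqs : irel (leqs L) = [set v | tnth v ord0 = tnth v ord_max]
}.

Definition recursive_interp (L : language) (R : recRing) (I : interp L R) :
  Prop :=
  (forall k (f : lfun L k), recursive_fun (@rep R) (ifun I f)) /\
  (forall k (r : lrel L k), recursive (irel I r)).

Inductive term (L : language) (n : nat) : Type :=
| TVar (i : 'I_n)
| TConst (c : lconst L)
| TApp k (f : lfun L k) (t : 'I_k -> term L n).

Inductive basic (L : language) (n : nat) : Type :=
| Basic k (r : lrel L k) (t : 'I_k -> term L n).

Section Semantics.
Variables (L : language) (R : pzRingType) (I : interp L R) (n : nat).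

Fixpoint teval (v : n.-tuple R) (t : term L n) : R :=
  match t with
  | TVar i => tnth v i
  | TConst c => iconst I c
  | TApp _ f ts => ifun I f (mktuple (fun i => teval v (ts i)))
  end.

Definition holds (v : n.-tuple R) (b : basic L n) : Prop :=
  let: Basic _ r ts := b in irel I r (mktuple (fun i => teval v (ts i))).

End Semantics.

Definition diophantine (L : language) (R : pzRingType) (I : interp L R)
  k (S : set (k.-tuple R)) : Prop :=
  exists l r (f : 'I_r -> basic L (k + l)),
    S = [set x : k.-tuple R | exists y : l.-tuple R,
                   forall i, holds I [tuple of x ++ y] (f i)].

Definition diophantine_map (L1 L2 : language) (R1 R2 : pzRingType)
  (I1 : interp L1 R1) (I2 : interp L2 R2) (d : R1 -> R2) : Prop :=
  forall k (S : set (k.-tuple R1)),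
    diophantine I1 S -> diophantine I2 (map_tuple d @` S).

Definition MRDP (L : language) (R : recRing) (I : interp L R) : Prop :=
  forall S : set R, re (pow1 S) -> diophantine I (pow1 S).

Definition re_preserving (R1 R2 : recRing) (f : R1 -> R2) : Prop :=
  forall S : set R1, re (pow1 S) -> re (pow1 (f @` S)).

(* Main.v *)
Require Import Defs.
From mathcomp Require Import all_boot all_algebra.
From mathcomp Require Import boolp classical_sets.

Set Implicit Arguments.
Unset Strict Implicit.
Unset Printing Implicit Defensive.
Local Open Scope classical_set_scope.

(** If [S] is recursively enumerable in [R1], MRDP makes it Diophantine, so
    [d S] is Diophantine in [R2]. It remains to see that every Diophantine set
    of a recursive ring with a recursive interpretation is recursively
    enumerable ([diophantine_re]). Evaluation of terms is recursive on codes
    ([teval_computable]), hence so is the truth of a finite conjunction of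
    basic formulas ([system_decided]); the existential quantifiers over the
    witnesses [y] are then handled by an unbounded search
    ([projection_nat_re]). The search avoids coding tuples by numbers: it looks
    for the least [t] such that some [y] with all entries below [t] is a
    witness, and for given [t] the finitely many such [y] are exhausted by
    nested bounded sums ([bounded_search]).

    Total recursive functions are handled extensionally, as functions on
    sequences of numbers ([computable]), and a truth value is represented by a
    number which is nonzero when the statement holds, so that conjunction is a
    product and bounded existential quantification is a sum. *)

(** * Total recursive functions *)

Lemma rgraph_functional n (f : recfun n) v y z :
  Defs.rgraph f v y -> Defs.rgraph f v z -> y = z.
Proof.
elim: f v y z => {n} [n||n i|n m f IHf g IHg|n f IHf g IHg|n f IHf] v y z /=.
- by move=> -> ->.
- by move=> -> ->.
- by move=> -> ->.
- move=> [w gw fw] [w' gw' fw']; have ew : w = w'.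
    by apply: eq_from_tnth => i; apply: IHg (gw i) (gw' i).
  by move: fw'; rewrite -ew; apply: IHf.
- move=> [s [s0 sS ->]] [s' [s0' sS' ->]].
  have es i : (i <= thead v)%N -> s i = s' i.
    elim: i => [_|i IHi lt_i]; first exact: IHf s0 s0'.
    apply: IHg (sS i lt_i) _.
    by rewrite (IHi (ltnW lt_i)); apply: sS'.
  exact: es.
- move=> [fy lty] [fz ltz]; case: (ltngtP y z) => // [/ltz | /lty] [w fw].
  + by have := IHf _ _ _ fy fw.
  + by have := IHf _ _ _ fz fw.
Qed.

(** [F] restricted to sequences of length [n] is a total recursive function;
    its values at other lengths are irrelevant. *)
Definition computable n (F : seq nat -> nat) : Prop :=
  exists f : recfun n,
    forall (v : n.-tuple nat) y, Defs.rgraph f v y <-> y = F v.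

Lemma eq_computable n (F G : seq nat -> nat) :
  (forall v : n.-tuple nat, F v = G v) -> computable n F -> computable n G.
Proof. by move=> eqFG [f fP]; exists f => v y; rewrite fP eqFG. Qed.

Lemma total_computable n (f : recfun n) :
  Defs.total f ->
  exists2 F, computable n F & forall v : n.-tuple nat, Defs.rgraph f v (F v).
Proof.
move=> ftot.
have /choice[F FP] (s : seq nat) :
    exists y, forall v : n.-tuple nat, val v = s -> Defs.rgraph f v y.
  have [sz|/eqP nsz] := boolP (size s == n); last first.
    by exists 0 => v vs; case: nsz; rewrite -vs size_tuple.
  have [y fy] := ftot (Tuple sz); exists y => v vs.
  by rewrite (_ : v = Tuple sz) //; apply: val_inj.
exists F => [|v]; last exact: FP.
exists f => v y; split=> [fy|->]; last exact: FP.
exact: rgraph_functional fy (FP _ v erefl).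
Qed.

Lemma computable_proj n i : (i < n)%N -> computable n (nth 0 ^~ i).
Proof.
by move=> lt_in; exists (Proj (Ordinal lt_in)) => v y /=; rewrite (tnth_nth 0).
Qed.

Lemma computable_comp m n F (G : 'I_m -> seq nat -> nat) :
  computable m F -> (forall i, computable n (G i)) ->
  computable n (fun s => F [seq G i s | i <- enum 'I_m]).
Proof.
move=> [f fP] /choice[g gP]; exists (Comp f g) => v y /=; split.
  move=> [w gw]; rewrite fP => ->; congr F.
  rewrite (_ : w = mktuple (fun i => G i v)) //.
  by apply: eq_from_tnth => i; rewrite tnth_mktuple; apply/gP.
move=> ->; exists (mktuple (fun i => G i v)); last exact/fP.
by move=> i; rewrite tnth_mktuple; apply/gP.
Qed.

Lemma computable_comp1 n F G :
  computable 1 F -> computable n G -> computable n (fun s => F [:: G s]).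
Proof.
move=> cF cG; have := computable_comp cF (fun _ : 'I_1 => cG).
by apply: eq_computable => v; rewrite enum_ordSl (size0nil (size_enum_ord 0)).
Qed.

Lemma computable_comp2 n F G H :
  computable 2 F -> computable n G -> computable n H ->
  computable n (fun s => F [:: G s; H s]).
Proof.
move=> cF cG cH.
have cGH (i : 'I_2) : computable n (if i == ord0 then G else H) by case: ifP.
have := computable_comp cF cGH.
by apply: eq_computable => v; rewrite !enum_ordSl (size0nil (size_enum_ord 0)).
Qed.

Lemma computable_succ : computable 1 (fun s => (nth 0 s 0).+1).
Proof. by exists Succ => v y /=; rewrite /thead (tnth_nth 0). Qed.

Lemma computable_const n c : computable n (fun=> c).
Proof.
elim: c => [|c IHc]; first by exists (Zero n).
exact: computable_comp1 computable_succ IHc.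
Qed.

Lemma computable_primrec n F G :
  computable n F -> computable n.+2 G ->
  computable n.+1 (fun s =>
    iteri (head 0 s) (fun i r => G [:: i, r & behead s]) (F (behead s))).
Proof.
move=> [f fP] [g gP]; exists (PrimRec f g) => v y /=.
have hv : thead v = head 0 v by rewrite /thead (tnth_nth 0) nth0.
rewrite hv.
split=> [[s [/fP s0 sS ->]]|->].
  have es i : (i <= head 0 v)%N ->
      s i = iteri i (fun i r => G [:: i, r & behead v]) (F (behead v)).
    elim: i => [_|i IHi lt_i]; first exact: s0.
    by have := sS i lt_i; rewrite gP /= (IHi (ltnW lt_i)).
  exact: es.
exists (fun i => iteri i (fun i r => G [:: i, r & behead v]) (F (behead v))).
by split=> // [|i _]; [exact/fP | exact/gP].
Qed.

Lemma computable_add n F G :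
  computable n F -> computable n G -> computable n (fun s => F s + G s).
Proof.
suff cadd : computable 2 (fun s => nth 0 s 0 + nth 0 s 1).
  by move=> cF cG; apply: (computable_comp2 cadd).
have cS : computable 3 (fun s => (nth 0 s 1).+1).
  exact: (computable_comp1 computable_succ (computable_proj _)).
have := computable_primrec (@computable_proj 1 0 isT) cS.
apply: eq_computable => v /=; rewrite nth_behead nth0.
by elim: (head 0 v) => //= k ->.
Qed.

Lemma computable_mul n F G :
  computable n F -> computable n G -> computable n (fun s => F s * G s).
Proof.
suff cmul : computable 2 (fun s => nth 0 s 0 * nth 0 s 1).
  by move=> cF cG; apply: (computable_comp2 cmul).
have cD : computable 3 (fun s => nth 0 s 1 + nth 0 s 2).
  by apply: computable_add; apply: computable_proj.
have := computable_primrec (computable_const 1 0) cD.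
apply: eq_computable => v /=; rewrite (nth0 0 v).
by elim: (head 0 v) => //= k ->; rewrite nth_behead mulSn addnC.
Qed.

Lemma computable_eq0 n F :
  computable n F -> computable n (fun s => nat_of_bool (F s == 0)).
Proof.
suff ceq0 : computable 1 (fun s => nat_of_bool (nth 0 s 0 == 0)).
  by move=> cF; apply: (computable_comp1 ceq0).
have := computable_primrec (computable_const 0 1) (computable_const 2 0).
by apply: eq_computable => v; rewrite nth0; case: (head 0 v).
Qed.

Lemma computable_prod (T : Type) n (r : seq T) (F : T -> seq nat -> nat) :
  (forall i, computable n (F i)) ->
  computable n (fun s => \prod_(i <- r) F i s).
Proof.
move=> cF; elim: r => [|i r IHr].
  by have := computable_const n 1; apply: eq_computable => v; rewrite big_nil.
have := computable_mul (cF i) IHr.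
by apply: eq_computable => v; rewrite big_cons.
Qed.

Lemma computable_bounded_sum n F i :
  computable n.+1 F -> (i < n)%N ->
  computable n (fun s => \sum_(y < nth 0 s i) F (val y :: s)).
Proof.
move=> cF lt_in.
(* In the recursion step the arguments are the index, the partial sum and
   then [s]; [p] skips the partial sum. *)
pose p (j : 'I_n.+1) := if val j is j'.+1 then j'.+2 else 0.
have cFp : computable n.+2 (fun s => F [seq nth 0 s (p j) | j <- enum 'I_n.+1]).
  apply: (computable_comp (G := fun j s => nth 0 s (p j)) cF) => j.
  by apply: computable_proj; rewrite /p; case: j => [[|j]].
have cstep := computable_add (@computable_proj n.+2 1 isT) cFp.
have crec := computable_primrec (computable_const n 0) cstep.
(* [q] selects the entry [i] of [s], as the bound of the recursion, followed by
   the whole of [s]. *)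
pose q (j : 'I_n.+1) := if val j is j'.+1 then j' else i.
have cq (j : 'I_n.+1) : computable n (nth 0 ^~ (q j)).
  by apply: computable_proj; rewrite /q; case: j => [[|j]].
have := computable_comp crec cq; apply: eq_computable => v.
have mapE (a : nat -> nat) :
    [seq a (val j) | j <- enum 'I_n.+1] = [seq a j | j <- iota 0 n.+1].
  by rewrite (map_comp a val) val_enum_ord.
have tl : [seq nth 0 v j | j <- iota 0 n] = v.
  by rewrite -[n in iota 0 n](size_tuple v) -/(mkseq _ _) mkseq_nth.
rewrite (mapE (fun j => nth 0 v (if j is j'.+1 then j' else i))) /=.
rewrite (iotaDl 1 0) -map_comp /= tl.
elim: (nth 0 v i) => [|t IHt] /=; first by rewrite big_ord0.
rewrite big_ord_recr /= IHt; congr (_ + F _).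
rewrite (mapE (fun j => nth 0 [:: t, _ & val v] (if j is j'.+1 then j'.+2 else 0))).
by rewrite /= (iotaDl 1 0) -map_comp /= tl.
Qed.

(** * Existential quantification by search *)

(** The search for [y] below a bound which is itself the first parameter: the
    bound [head 0 w] stands at position [l] of [y ++ w], where the successive
    bounded sums, which each eliminate the first entry of [y], can read it. *)
Lemma bounded_search l m F : computable (l + m.+1) F ->
  exists2 G, computable m.+1 G & forall w : m.+1.-tuple nat,
    (0 < G w)%N <-> exists y : l.-tuple nat,
                   all (ltn^~ (head 0 w)) y /\ (0 < F (y ++ w))%N.
Proof.
elim: l F => [|l IHl] F cF.
  exists F => // w; split=> [Fw|[y]]; last by rewrite (tuple0 y); case.
  by exists [tuple].
have lt_l : (l < l + m.+1)%N by rewrite addnS ltnS leq_addr.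
have [G cG GP] := IHl _ (computable_bounded_sum cF lt_l).
exists G => // w; rewrite {}GP.
have bnd (y : l.-tuple nat) : nth 0 (y ++ w) l = head 0 w.
  by rewrite nth_cat size_tuple ltnn subnn nth0.
split=> [[y [ally]]|[yy [allyy Fy]]].
  rewrite bnd lt0n sum_nat_eq0 negb_forall => /existsP[a].
  rewrite /= -lt0n => Fa; exists [tuple of val a :: y]; split=> //=.
  by rewrite ally ltn_ord.
case/tupleP: yy allyy Fy => a y /= /andP[lta ally] Fy.
exists y; split=> //; rewrite bnd lt0n sum_nat_eq0 negb_forall.
by apply/existsP; exists (Ordinal lta); rewrite /= -lt0n.
Qed.

(** A projection of a recursive relation is recursively enumerable. *)
Lemma projection_nat_re k l F : computable (k + l) F ->
  nat_re [set x : k.-tuple nat | exists y : l.-tuple nat, (0 < F (x ++ y))%N].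
Proof.
move=> cF.
(* [p] selects the entries of [x ++ y] in [y ++ t :: x], the order of the
   variables in [bounded_search]. *)
pose p i := if (i < k)%N then l.+1 + i else i - k.
have cp (i : 'I_(k + l)) : computable (l + k.+1) (nth 0 ^~ (p i)).
  apply: computable_proj; rewrite /p; case: (ltnP i k) => [lt_ik|le_ki].
    by rewrite addSnnS ltn_add2l ltnS.
  by rewrite ltn_subLR // (leq_trans (ltn_ord i)) // leq_add2l leq_addr.
have [G cG GP] := bounded_search (computable_comp cF cp).
have pE (x : k.-tuple nat) t (y : l.-tuple nat) :
    [seq nth 0 (y ++ t :: x) (p (val i)) | i <- enum 'I_(k + l)] = x ++ y.
  rewrite (map_comp (fun j => nth 0 (y ++ t :: x) (p j)) (val : 'I_(k + l) -> nat)).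
  rewrite val_enum_ord; apply: (@eq_from_nth _ 0) => [|i].
    by rewrite size_map size_iota size_cat !size_tuple.
  rewrite size_map size_iota => lt_i.
  rewrite (nth_map 0) ?size_iota // nth_iota // add0n !nth_cat !size_tuple /p.
  case: (ltnP i k) => [lt_ik|le_ki]; last by rewrite ltn_subLR // lt_i.
  by rewrite addSnnS ltnNge leq_addr addKn.
have [f fP] := computable_eq0 cG.
(* [Mu] looks for a zero, hence the test [G _ == 0]. *)
exists (Mu f) => x; split=> [[y Fy]|[t [/fP Gt _]]]; last first.
  have /GP[y [_]] : (0 < G (t :: x))%N.
    by move: Gt => /=; rewrite lt0n; case: eqP.
  by rewrite pE; exists y.
have exG : exists t, (0 < G (t :: x))%N.
  (* The sum of the entries of [y] bounds each of them. *)
  exists (sumn y).+1; apply/(GP [tuple of _ :: x]); exists y.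
  rewrite pE; split=> //; apply/allP => a ay /=; rewrite ltnS.
  by rewrite (perm_sumn (perm_to_rem ay)) leq_addr.
have [t Gt tmin] := ex_minnP exG.
exists t; split=> [|z lt_zt]; first by apply/fP; rewrite /= eqn0Ngt Gt.
exists 0; apply/fP => /=; case: posnP => // Gz.
by rewrite ltnNge tmin in lt_zt.
Qed.

(** * Diophantine sets are recursively enumerable *)

Lemma nat_recursive_decided k (A : set (k.-tuple nat)) : nat_recursive A ->
  exists2 F, computable k F & forall v : k.-tuple nat, (0 < F v)%N <-> A v.
Proof.
move=> [chi chiP].
have [v|F cF FP] := @total_computable _ chi.
  have [Av|nAv] := EM (A v).
    by exists 1; apply: (chiP v).1.
  by exists 0; apply: (chiP v).2.
exists F => // v; have [Av|nAv] := EM (A v).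
  by rewrite (rgraph_functional (FP v) ((chiP v).1 Av)).
by rewrite (rgraph_functional (FP v) ((chiP v).2 nAv)).
Qed.

Lemma prod_gt0P r (F : 'I_r -> nat) :
  (0 < \prod_(i < r) F i)%N <-> forall i, (0 < F i)%N.
Proof.
split=> [Fgt0 i|]; last exact: prodn_gt0.
by move: Fgt0; rewrite (bigD1 i) //= muln_gt0 => /andP[].
Qed.

Lemma tuple_catP (T : Type) k l (v : (k + l).-tuple T) :
  exists (x : k.-tuple T) (y : l.-tuple T), v = [tuple of x ++ y].
Proof.
have szx : size (take k v) == k by rewrite size_takel // size_tuple leq_addr.
have szy : size (drop k v) == l by rewrite size_drop size_tuple addKn.
by exists (Tuple szx), (Tuple szy); apply: val_inj; rewrite /= cat_take_drop.
Qed.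

Lemma map_tuple_inj (T U : Type) (f : T -> U) n :
  injective f -> injective (fun v : n.-tuple T => map_tuple f v).
Proof.
by move=> inj_f u v /(congr1 val) /= /(inj_map inj_f) euv; apply: val_inj.
Qed.

Section RecursiveInterpretation.
Variables (R : recRing) (L : language) (I : interp L R).
Hypothesis recI : recursive_interp I.

Lemma teval_computable n (t : term L n) :
  exists2 F, computable n F &
    forall v : n.-tuple R, F (map (@rep R) v) = rep (teval I v t).
Proof.
elim: t => [i|c|k f ts IHt] /=.
- exists (nth 0 ^~ i); first exact: computable_proj.
  by move=> v; rewrite -tnth_map (tnth_nth 0).
- by exists (fun=> rep (iconst I c)); first exact: computable_const.
- have [F /total_computable[H cH HP] Ff] := recI.1 _ f.
  have /choice[G GP] i : exists G, computable n G /\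
      forall v : n.-tuple R, G (map (@rep R) v) = rep (teval I v (ts i)).
    by have [G] := IHt i; exists G.
  exists (fun s => H [seq G i s | i <- enum 'I_k]).
    by apply: computable_comp => // i; have [] := GP i.
  move=> v; set u := mktuple _.
  have -> : [seq G i (map (@rep R) v) | i <- enum 'I_k] = map_tuple (@rep R) u.
    by rewrite /= -map_comp; apply: eq_map => i /=; have [_ ->] := GP i.
  exact: rgraph_functional (HP _) (Ff u).
Qed.

Lemma holds_decided n (b : basic L n) :
  exists2 F, computable n F &
    forall v : n.-tuple R, (0 < F (map (@rep R) v))%N <-> holds I v b.
Proof.
case: b => k r ts /=.
have [H cH HP] := nat_recursive_decided (recI.2 _ r).
have /choice[G GP] i : exists G, computable n G /\
    forall v : n.-tuple R, G (map (@rep R) v) = rep (teval I v (ts i)).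
  by have [G] := teval_computable (ts i); exists G.
exists (fun s => H [seq G i s | i <- enum 'I_k]).
  by apply: computable_comp => // i; have [] := GP i.
move=> v; set u := mktuple _.
have -> : [seq G i (map (@rep R) v) | i <- enum 'I_k] = map_tuple (@rep R) u.
  by rewrite /= -map_comp; apply: eq_map => i /=; have [_ ->] := GP i.
rewrite HP; split=> [[u' ru' /(map_tuple_inj (@rep_inj R)) <-]//|ru].
by exists u.
Qed.

(** The recursive image of [rep] makes it decidable whether a sequence of
    numbers consists of codes. *)
Lemma codes_decided n :
  exists2 F, computable n F & forall z : n.-tuple nat,
    (0 < F z)%N <-> exists v : n.-tuple R, z = map_tuple (@rep R) v.
Proof.
have [D cD DP] := nat_recursive_decided (@rep_image R).
have DE a : (0 < D [:: a])%N <-> range (@rep R) a.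
  rewrite (DP [tuple a]); split=> [[b rb /(congr1 val)[<-]]//|ra].
  by exists a.
exists (fun s => \prod_(i < n) D [:: nth 0 s i]).
  apply: (@computable_prod _ n _ (fun i s => D [:: nth 0 s (val i)])) => i.
  exact: (computable_comp1 cD (computable_proj (ltn_ord i))).
move=> z; rewrite prod_gt0P; split=> [zP|[v ->] i]; last first.
  by apply/DE; rewrite -tnth_nth tnth_map; exists (tnth v i).
have /choice[g gP] (i : 'I_n) : exists x : R, rep x = tnth z i.
  by have /DE[x _ xz] := zP i; exists x; rewrite xz -tnth_nth.
exists (mktuple g); apply: eq_from_tnth => i.
by rewrite tnth_map tnth_mktuple gP.
Qed.

(** The truth of a system of basic formulas is decidable on all sequences of
    numbers, those which are not codes of elements of [R] being rejected. *)
Lemma system_decided n r (f : 'I_r -> basic L n) :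
  exists2 F, computable n F & forall z : n.-tuple nat,
    (0 < F z)%N <-> exists2 v : n.-tuple R,
      z = map_tuple (@rep R) v & forall i, holds I v (f i).
Proof.
have [D cD DP] := codes_decided n.
have /choice[G GP] i : exists G, computable n G /\
    forall v : n.-tuple R, (0 < G (map (@rep R) v))%N <-> holds I v (f i).
  by have [G] := holds_decided (f i); exists G.
exists (fun s => D s * \prod_(i < r) G i s).
  by apply: computable_mul => //; apply: computable_prod => i; have [] := GP i.
move=> z; rewrite muln_gt0; split=> [/andP[/DP[v ->] /prod_gt0P fv]|[v -> fv]].
  by exists v => // i; apply/(GP i).2/fv.
apply/andP; split; first by apply/DP; exists v.
by apply/prod_gt0P => i; apply/(GP i).2/fv.
Qed.

Lemma diophantine_re k (S : set (k.-tuple R)) : diophantine I S -> re S.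
Proof.
move=> [l [r [f ->]]]; have [F cF FP] := system_decided f.
have [g gP] := projection_nat_re cF; exists g => x; rewrite -gP.
split=> [[u [y fuy] <-]|[y /(FP [tuple of x ++ y])[v exy fv]]].
  exists (map_tuple (@rep R) y); apply/(FP [tuple of _ ++ _]).
  exists [tuple of u ++ y] => //.
  by apply: val_inj; rewrite /= map_cat.
have [u [w vE]] := tuple_catP v; rewrite {v}vE in exy fv.
exists u; first by exists w.
move/(congr1 val): exy => /= /eqP; rewrite map_cat eqseq_cat; last first.
  by rewrite size_map !size_tuple.
by case/andP => /eqP ex _; apply: val_inj.
Qed.

End RecursiveInterpretation.

Theorem lemma6p21 (R1 R2 : recRing) (L1 L2 : language)
  (I1 : interp L1 R1) (I2 : interp L2 R2)
  (recI1 : recursive_interp I1) (recI2 : recursive_interp I2)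
  (mrdp1 : MRDP I1) (d : R1 -> R2) (dioph_d : diophantine_map I1 I2 d) :
  re_preserving d.
Proof.
move=> S /mrdp1 /dioph_d.
have -> : map_tuple d @` pow1 S = pow1 (d @` S).
  apply/seteqP; split=> [_ [_ [x Sx <-] <-]|_ [_ [x Sx <-] <-]].
    by exists (d x); [exists x | apply: val_inj].
  by exists [tuple x]; [exists x | apply: val_inj].
exact: diophantine_re.
Qed.
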